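(* Let $\bar x\in\mathbb{R}^n$ be a weakly minimal solution of the set optimization problem $\preceq^l\text{-}\min_{x\in\mathbb{R}^n}F(x)$, and let $\bar a\in P_{\bar x}$ and $\bar u\in\mathbb{R}^n$ be such that $\Phi(\bar x)=\xi_{\bar x}(\bar a,\bar u)$. Then $\bar u=0$.
   Context: $K\subseteq\mathbb{R}^m$ is a closed, convex, pointed ($K\cap(-K)=\{0\}$), solid ($\operatorname{int}K\neq\emptyset$) cone. For $y,z\in\mathbb{R}^m$: $y\preceq z$ iff $z-y\in K$, and $y\prec z$ iff $z-y\in\operatorname{int}(K)$. Standing assumption: $F(x)=\{f^1(x),\ldots,f^p(x)\}$ for $x\in\mathbb{R}^n$, where $f^1,\ldots,f^p:\mathbb{R}^n\to\mathbb{R}^m$ are twice continuously differentiable and $K$-strongly convex with respect to a common $e\in\operatorname{int}(K)$: there are $\rho_1,\ldots,\rho_p>0$ such that for every $i\in[p]=\{1,\ldots,p\}$, $x_1,x_2\in\mathbb{R}^n$, $\lambda\in[0,1]$, $f^i(\lambda x_1+(1-\lambda)x_2)\preceq\lambda f^i(x_1)+(1-\lambda)f^i(x_2)-\tfrac12\rho_i\lambda(1-\lambda)\|x_1-x_2\|^2e$. For $f^i=(f^{i,1},\ldots,f^{i,m})^\top$ and $u\in\mathbb{R}^n$, $\nabla f^i(x)^\top u\in\mathbb{R}^m$ denotes the Jacobian of $f^i$ at $x$ applied to $u$, and $u^\top\nabla^2f^i(x)u$ denotes the vector $(u^\top\nabla^2f^{i,1}(x)u,\ldots,u^\top\nabla^2f^{i,m}(x)u)^\top\in\mathbb{R}^m$.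 Gerstewitz function: $\Psi_e(z)=\min\{t\in\mathbb{R}: te\in z+K\}$, $z\in\mathbb{R}^m$. For nonempty $A,B\subseteq\mathbb{R}^m$: $A\prec^lB$ iff $B\subseteq A+\operatorname{int}(K)$. A point $\bar x$ is a weakly minimal solution of the set optimization problem if there is no $x\in\mathbb{R}^n$ with $F(x)\prec^lF(\bar x)$. $\operatorname{Min}(A,K)=\{z\in A:(z-K)\cap A=\{z\}\}$. $I(x)=\{i\in[p]:f^i(x)\in\operatorname{Min}(F(x),K)\}$; $w(x)=|\operatorname{Min}(F(x),K)|$; for $r\in\mathbb{R}^m$, $I_r(x)=\{i\in I(x):f^i(x)=r\}$. Fixing an enumeration $\{r_1^x,\ldots,r_{w(x)}^x\}$ of $\operatorname{Min}(F(x),K)$, the partition set at $x$ is $P_x=\prod_{j=1}^{w(x)}I_{r_j^x}(x)$; its elements are written $a=(a_1,\ldots,a_{w(x)})$. For $x\in\mathbb{R}^n$, $a\in P_x$, $u\in\mathbb{R}^n$: $\xi_x(a,u)=\max_{j\in[w(x)]}\Psi_e\big(\nabla f^{a_j}(x)^\top u+\tfrac12u^\top\nabla^2f^{a_j}(x)u\big)$, and $\Phi(x)=\min_{(a,u)\in P_x\times\mathbb{R}^n}\xi_x(a,u)$. *)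

(* Defs.v *)
From mathcomp Require Import all_boot all_order all_algebra finmap.
From mathcomp Require Import all_classical all_reals all_analysis.

Set Implicit Arguments.
Unset Strict Implicit.
Unset Printing Implicit Defensive.

Import Order.TTheory GRing.Theory Num.Theory.
Import numFieldNormedType.Exports.

Local Open Scope classical_set_scope.
Local Open Scope ring_scope.

(* Vectors are row vectors, so that the Jacobian of g at x applied to u reads
   [u *m 'J g x]. The norm that the library puts on 'rV[R]_n is the sup norm:
   it is used for the topology and differentiability only. *)

Section RealSets.
Context {R : realType}.

(* Minimum and maximum of a set of reals; 0 if they are not attained. *)
Definition setmin (A : set R) : R := xget 0 (A `&` lbound A).
Definition setmax (A : set R) : R := xget 0 (A `&` ubound A).

End RealSets.

Section Smoothness.
Context {R : realType} {n : nat}.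
Implicit Types (g : 'rV[R]_n -> R) (x u : 'rV[R]_n).

Definition enorm u : R := Num.sqrt (\sum_(k < n) u 0 k ^+ 2).

Definition gradient g x : 'rV[R]_n := \row_k 'D_(delta_mx 0 k) g x.

Definition hessian g x : 'M[R]_n :=
  \matrix_(k, l) 'D_(delta_mx 0 k) ('D_(delta_mx 0 l) g) x.

Definition twice_continuously_differentiable g : Prop :=
  [/\ forall x, differentiable g x,
      forall x, differentiable (gradient g) x
    & continuous (hessian g)].

End Smoothness.

Section VectorFunctions.
Context {R : realType} {n m : nat}.
Implicit Types (g : 'rV[R]_n -> 'rV[R]_m) (x u : 'rV[R]_n).

Definition component g (k : 'I_m) : 'rV[R]_n -> R := fun x => g x 0 k.

Definition hessian_form g x u : 'rV[R]_m :=
  \row_k (u *m hessian (component g k) x *m u^T) 0 0.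

End VectorFunctions.

Section ConeOrder.
Context {R : realType} {m : nat}.
Implicit Types (K A B : set 'rV[R]_m) (y z e : 'rV[R]_m).

Definition closed_convex_pointed_solid_cone K : Prop :=
  [/\ forall t z, 0 <= t -> K z -> K (t *: z),
      closed K,
      convex_set K,
      K `&` [set - z | z in K] = [set 0]
    & K° !=set0].

Definition cone_le K y z : Prop := K (z - y).

Definition strongly_convex {n : nat} K e (rho : R)
    (g : 'rV[R]_n -> 'rV[R]_m) : Prop :=
  forall (x1 x2 : 'rV[R]_n) (l : R), 0 <= l <= 1 ->
    cone_le K (g (l *: x1 + (1 - l) *: x2))
      (l *: g x1 + (1 - l) *: g x2
       - (2^-1 * rho * l * (1 - l) * enorm (x1 - x2) ^+ 2) *: e).

Definition gerstewitz K e z : R :=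
  setmin [set t | [set z + k | k in K] (t *: e)].

Definition lower_less K A B : Prop :=
  B `<=` [set a + k | a in A & k in K°].

Definition Min A K : set 'rV[R]_m :=
  [set z | A z /\ [set z - k | k in K] `&` A = [set z]].

End ConeOrder.

Section SetOptimization.
Context {R : realType} {n m p : nat}.
Variables (K : set 'rV[R]_m) (e : 'rV[R]_m).
Variable f : 'I_p -> 'rV[R]_n -> 'rV[R]_m.
Implicit Types (x u : 'rV[R]_n).

Definition F x : set 'rV[R]_m := [set f i x | i in [set: 'I_p]].

Definition weakly_minimal x : Prop :=
  ~ exists y, lower_less K (F y) (F x).

Definition I_min x : set 'I_p := [set i | Min (F x) K (f i x)].

Definition I_at x (r : 'rV[R]_m) : set 'I_p :=
  [set i | I_min x i /\ f i x = r].

Definition w x : nat := #|` fset_set (Min (F x) K)|%fset.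

Definition enumerates (r : forall x, 'I_(w x) -> 'rV[R]_m) : Prop :=
  forall x, set_bij [set: 'I_(w x)] (Min (F x) K) (r x).

Definition partition_set (r : forall x, 'I_(w x) -> 'rV[R]_m) x
    : set {ffun 'I_(w x) -> 'I_p} :=
  [set a | forall j, I_at x (r x j) (a j)].
Arguments partition_set r x : clear implicits.

Definition xi x (a : {ffun 'I_(w x) -> 'I_p}) u : R :=
  setmax [set gerstewitz K e
                (u *m 'J (f (a j)) x + 2^-1 *: hessian_form (f (a j)) x u)
         | j in [set: 'I_(w x)]].
Arguments xi x a u : clear implicits.

Definition Phi (r : forall x, 'I_(w x) -> 'rV[R]_m) x : R :=
  setmin [set xi x au.1 au.2 | au in partition_set r x `*` [set: 'rV[R]_n]].

End SetOptimization.

Arguments F {R n m p} f x.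
Arguments weakly_minimal {R n m p} K f x.
Arguments I_min {R n m p} K f x.
Arguments I_at {R n m p} K f x r.
Arguments w {R n m p} K f x.
Arguments enumerates {R n m p} K f r.
Arguments partition_set {R n m p} K f r x _.
Arguments xi {R n m p} K e f x a u.
Arguments Phi {R n m p} K e f r x.

(* Main.v *)
(* Taking u = 0 gives Phi <= 0, so every second-order model of a selected f^i
   at ubar has nonpositive Gerstewitz value, i.e. lies in - K. Strong
   convexity, through second symmetric differences, puts
   u^T (Hess f^i) u - rho_i |u|^2 e in K, so if ubar <> 0 the directional
   derivative of each selected f^i along ubar lies in - int K. A short step
   along ubar then strictly improves every minimal element of F(xbar), hence,
   by domination in a finite set, all of F(xbar). *)
Require Import Defs.
From mathcomp Require Import all_boot all_order all_algebra finmap.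
From mathcomp Require Import all_classical all_reals all_analysis.
From mathcomp Require Import ring lra.

Import Order.TTheory GRing.Theory Num.Theory.
Import numFieldNormedType.Exports.

Local Open Scope classical_set_scope.
Local Open Scope ring_scope.

Lemma cvg_mx_entrywise (R : realType) (m n : nat) (T : Type)
  (F : set_system T) (FF : Filter F) (M : T -> 'M[R]_(m, n)) (l : 'M[R]_(m, n)) :
  (forall i j, M t i j @[t --> F] --> l i j) -> M t @[t --> F] --> l.
Proof.
move=> Ml; apply/cvgrPdist_le => /= eps eps0.
near=> t.
rewrite /Num.Def.normr/= mx_normrE (bigmax_le _ (ltW eps0))//= => i _.
rewrite !mxE/=.
move: i; near: t; apply: filter_forall => /= i.
exact: ((cvgrPdist_le _ _).1 (Ml i.1 i.2)).
Unshelve. all: by end_near. Qed.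

(** * Second directional derivatives and symmetric differences *)

Section Smoothness.
Context {R : realType} {n : nat}.
Implicit Types (g : 'rV[R]_n -> R) (x u : 'rV[R]_n).

Lemma differentiable_row {m : nat} (h : 'rV[R]_n -> 'rV[R]_m) x :
  (forall k, differentiable (component h k) x) -> differentiable h x.
Proof.
move=> dh.
have -> : h = \sum_(k < m) (fun y => component h k y *: delta_mx 0 k).
  apply/funext => y; rewrite fct_sumE [LHS]row_sum_delta.
  by apply: eq_bigr.
by apply: differentiable_sum => k; exact: differentiableZl.
Qed.

Lemma derive_coords g x u : differentiable g x ->
  'D_u g x = \sum_k u 0 k * 'D_(delta_mx 0 k) g x.
Proof.
move=> dg; rewrite deriveE// [in LHS](row_sum_delta u) linear_sum.
by apply: eq_bigr => k _; rewrite linearZ deriveE.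
Qed.

(** ['D_u g] is a fixed linear combination of the partial derivatives, and these are the coordinates
    of [gradient g]; differentiating the combination once more yields the quadratic form. *)
Lemma hessian_derive2 g x u : (forall y, differentiable g y) ->
  differentiable (gradient g) x ->
  differentiable ('D_u g) x /\
  'D_u ('D_u g) x = (u *m hessian g x *m u^T) 0 0.
Proof.
move=> dg dgrad.
have dpart l : differentiable ('D_(delta_mx 0 l) g) x.
  have -> : 'D_(delta_mx 0 l) g = (fun M : 'rV[R]_n => M 0 l) \o gradient g.
    by apply/funext => y; rewrite /= mxE.
  by apply: differentiable_comp => //; exact: differentiable_coord.
have DE : 'D_u g = \sum_(l < n) (u 0 l *: 'D_(delta_mx 0 l) g).
  by apply/funext => y; rewrite derive_coords// fct_sumE.
have dpartZ l : differentiable (u 0 l *: 'D_(delta_mx 0 l) g) x.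
  exact: differentiableZ.
split; first by rewrite DE; exact: differentiable_sum.
rewrite [in LHS]DE derive_sum; last by move=> l; exact: diff_derivable.
rewrite mxE; apply: eq_bigr => l _.
rewrite deriveZ; last exact: diff_derivable.
rewrite derive_coords// !mxE /GRing.scale/= mulrC; congr *%R.
by apply: eq_bigr => k _; rewrite !mxE.
Qed.

(** Both derivatives are limits of literally the same difference quotient. *)
Lemma is_derive_line g x u t : derivable g (t *: u + x) u ->
  is_derive t (1 : R) (fun s => g (s *: u + x)) ('D_u g (t *: u + x)).
Proof.
have E : (fun h : R => h^-1 *: (((fun s => g (s *: u + x)) \o shift t) (h *: 1) -
    g (t *: u + x))) =
  (fun h : R => h^-1 *: ((g \o shift (t *: u + x)) (h *: u) - g (t *: u + x))).
  by apply/funext => h /=; rewrite [h *: 1]mulr1 scalerDl addrA.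
by move=> dg; apply: DeriveDef; rewrite /derivable/derive E.
Qed.

Lemma derive_oppr g x u : differentiable g x -> 'D_(- u) g x = - 'D_u g x.
Proof. by move=> dg; rewrite deriveE// linearN -deriveE. Qed.

(* L'Hopital's rule applied once, since D_u g is differentiable at x only. *)
Lemma second_difference_cvg g x u : (forall y, differentiable g y) ->
  differentiable ('D_u g) x ->
  (g (t *: u + x) + g (t *: - u + x) - 2 * g x) / t ^+ 2 @[t --> 0^'+]
    --> 'D_u ('D_u g) x.
Proof.
move=> dg ddg; set G := 'D_u g.
have quotient_cvg v : t^-1 * (G (t *: v + x) - G x) @[t --> 0^'+] --> 'D_v G x.
  exact/cvg_dnbhs_at_right/diff_derivable.
have line_cvg v : g (t *: v + x) @[t --> 0^'+] --> g x.
  have /cvg_at_right_filter : g (t *: v + x) @[t --> (0 : R)] --> g (0 *: v + x).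
    apply/differentiable_continuous/derivable1_diffP.
    by case: (@is_derive_line g x v 0); first exact: diff_derivable.
  by rewrite scale0r add0r.
apply: (@lhopital_at_right _ _
  (fun t => G (t *: u + x) + 'D_(- u) g (t *: - u + x) - 0) _
  (fun t => 2 * t) 0 1) => //.
- move=> t _; apply: is_deriveB; apply: is_deriveD;
    exact/is_derive_line/diff_derivable.
- by move=> t _; apply: is_derive_eq; rewrite [t%:A]mulr1 -mulr2n mulr_natl.
- have E : g x + g x - 2 * g x = 0 by ring.
  rewrite -[X in _ --> X]E.
  by apply: cvgB; [apply: cvgD|exact: cvg_cst].
- rewrite -[X in _ --> X](expr0n R 2).
  by apply: cvg_at_right_filter; exact: exprn_continuous.
- by move=> t; rewrite in_itv/= => /andP[t0 _]; rewrite mulf_neq0 ?gt_eqF.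
(* The quotient of derivatives is half the difference of the difference quotients of [G] along [u]
   and [- u]; the limit is rewritten in that shape. *)
have -> : 'D_u G x = 2^-1 * ('D_u G x - 'D_(- u) G x).
  rewrite derive_oppr//.
  by field.
have half_cvg : 2^-1 * (t^-1 * (G (t *: u + x) - G x) -
    t^-1 * (G (t *: - u + x) - G x)) @[t --> 0^'+]
    --> 2^-1 * ('D_u G x - 'D_(- u) G x).
  by apply: cvgM; [exact: cvg_cst|apply: cvgB; exact: quotient_cvg].
apply: cvg_trans half_cvg.
apply: near_eq_cvg; near=> t.
have t0 : t != 0 by rewrite gt_eqF.
rewrite derive_oppr// -/(G _).
by field.
Unshelve. all: by end_near. Qed.

End Smoothness.

(** * Attained minima and maxima, and their default value *)

Lemma setmin_le0 {R : realType} (A : set R) : A 0 -> setmin A <= 0.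
Proof.
by move=> A0; rewrite /setmin; case: xgetP => [t -> [_ lbt]|_ //]; exact: lbt.
Qed.

(** The bound [0 <= b] covers the default value 0 of an unattained maximum. *)
Lemma setmax_le {R : realType} (A : set R) (b : R) :
  0 <= b -> ubound A b -> setmax A <= b.
Proof.
by move=> b0 ubA; rewrite /setmax; case: xgetP => [t -> [At _]|_ //]; exact: ubA.
Qed.

Lemma le_setmax_range {R : realType} {I : finType} (g : I -> R) (i : I) :
  g i <= setmax [set g j | j in [set: I]].
Proof.
have [j _ gj] := @arg_maxP _ _ I i xpredT g isT.
have max_ex : exists t, ([set g k | k in [set: I]] `&`
    ubound [set g k | k in [set: I]]) t.
  by exists (g j); split; [exists j|move=> _ [k _ <-]; exact: gj].
by have [_] := xgetPex 0 max_ex; apply; exists i.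
Qed.

Lemma setmin_closed {R : realType} (A : set R) :
  A !=set0 -> closed A -> has_lbound A -> A (setmin A).
Proof.
move=> A0 cA lbA; have infA : has_inf A by [].
suff Ainf : A (inf A).
  have [] // : (A `&` lbound A) (setmin A).
  by apply: xgetPex; exists (inf A); split=> //; exact: ge_inf.
apply: cA => B /nbhs_ballP[eps /= eps0 epsB].
have [t At tinf] := inf_adherent eps0 infA.
exists t; split=> //; apply: epsB.
by rewrite /ball/= ler0_norm ?subr_le0 ?ge_inf// opprB ltrBlDl.
Qed.

(** * Cone arithmetic and the Gerstewitz function *)

Section Cone.
Context {R : realType} {m : nat}.
Variable K : set 'rV[R]_m.
Hypothesis hK : closed_convex_pointed_solid_cone K.

Lemma coneZ t z : 0 <= t -> K z -> K (t *: z).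
Proof. by case: hK => + _ _ _ _; apply. Qed.

(** The sum is twice the midpoint, which lies in [K] by convexity. *)
Lemma coneD y z : K y -> K z -> K (y + z).
Proof.
move=> Ky Kz; case: hK => _ _ convK _ _.
have h01 : 0 <= (2^-1 : R) <= 1 by lra.
have := convK y z (Itv01 (andP h01).1 (andP h01).2) (mem_set Ky) (mem_set Kz).
rewrite inE => /(@coneZ 2 _ (ler0n _ _)); rewrite /conv/=.
rewrite scalerDr !scalerA /unstable.onem.
have -> : 2 * 2^-1 = 1 :> R by field.
have -> : 2 * (1 - 2^-1) = 1 :> R by field.
by rewrite !scale1r.
Qed.

Lemma cone_antisym z : K z -> K (- z) -> z = 0.
Proof.
move=> Kz KNz; case: hK => _ _ _ pK _.
have : (K `&` [set - y | y in K]) z by split=> //; exists (- z); rewrite ?opprK.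
by rewrite pK.
Qed.

Lemma cone0 : K 0.
Proof.
case: hK => _ _ _ _ [z /interior_subset Kz].
by rewrite -(scale0r z); exact: coneZ.
Qed.

Lemma coneD_interior y z : K y -> K° z -> K° (y + z).
Proof.
move=> Ky; rewrite /interior => Kz.
have c : (v - y) @[v --> y + z] --> z.
  have E : y + z - y = z by rewrite addrC addKr.
  by rewrite -[X in _ --> X]E; exact: (cvgB cvg_id (cvg_cst _)).
have : \forall v \near y + z, K (v - y) by exact: c.
apply: filterS => v Kv.
by rewrite -(subrK y v); exact: coneD.
Qed.

Lemma coneZ_interior t z : 0 < t -> K° z -> K° (t *: z).
Proof.
move=> t0; rewrite /interior => Kz.
have c : (t^-1 *: v) @[v --> t *: z] --> z.
  rewrite -[X in _ --> X](scalerK (lt0r_neq0 t0) z).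
  exact: scaler_continuous.
have : \forall v \near t *: z, K (t^-1 *: v) by exact: c.
apply: filterS => v Kv.
by rewrite -(scalerKV (lt0r_neq0 t0) v); apply: coneZ => //; exact: ltW.
Qed.

Variable e : 'rV[R]_m.
Hypothesis he : K° e.
Hypothesis K0 : ~ K° 0.

(** Otherwise pointedness would force [e = 0], making 0 an interior point. *)
Lemma cone_notN : ~ K (- e).
Proof.
move=> KNe; have e0 := cone_antisym _ (interior_subset he) KNe.
by apply: K0; rewrite -e0.
Qed.

Let upper_translates z := [set t : R | [set z + k | k in K] (t *: e)].

Let upper_translatesE z t : upper_translates z t <-> K (t *: e - z).
Proof.
split; first by case=> k Kk /= <-; rewrite addrC addKr.
by move=> Kt; exists (t *: e - z) => //; rewrite addrC subrK.
Qed.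

(** The admissible [t] form a nonempty closed set bounded below, so the minimum is genuine and not
    the default value. *)
Lemma gerstewitz_attained z : K (gerstewitz K e z *: e - z).
Proof.
apply/upper_translatesE; rewrite /gerstewitz; apply: setmin_closed.
(* Nonemptiness: [e - s *: z] stays in [K] for small [s > 0], and scaling by [s^-1] makes [s^-1]
   admissible. *)
- have c : (e - s *: z) @[s --> (0 : R)^'+] --> e.
    rewrite -[X in _ --> X]subr0 -(scale0r z).
    apply: cvg_at_right_filter; apply: cvgB; first exact: cvg_cst.
    by apply: cvgZr_tmp; exact: cvg_id.
  near (0 : R)^'+ => s.
  have s0 : 0 < s by [].
  exists s^-1; apply/upper_translatesE.
  have -> : s^-1 *: e - z = s^-1 *: (e - s *: z).
    by rewrite scalerBr scalerK// gt_eqF.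
  apply: coneZ; first by rewrite invr_ge0 ltW.
  by near: s; exact: c.
- have -> : [set t | [set z + k | k in K] (t *: e)] =
      (fun t => t *: e - z) @^-1` K.
    by apply/seteqP; split=> t /upper_translatesE.
  case: hK => _ cK _ _ _; apply: preimage_closed => // t _.
  apply: cvgB; last exact: cvg_cst.
  by apply: cvgZr_tmp; exact: cvg_id.
(* Lower bound: [- e - s *: z] stays outside [K] for small [s > 0], whereas a very negative
   admissible [t] would put it in [K] with [s = (- t)^-1]. *)
- have cNK : open (~` K) by case: hK => _ cK _ _ _; exact: closed_openC.
  have c : (- e - s *: z) @[s --> (0 : R)^'+] --> - e.
    rewrite -[X in _ --> X]subr0 -(scale0r z).
    apply: cvg_at_right_filter; apply: cvgB; first exact: cvg_cst.
    by apply: cvgZr_tmp; exact: cvg_id.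
  have /c : nbhs (- e) (~` K).
    by apply: open_nbhs_nbhs; split=> //; exact: cone_notN.
  move=> [d /= d0 dK].
  (* Any [t] below this value is negative and satisfies [(- t)^-1 < d]. *)
  exists (- d^-1 - 1) => t /upper_translatesE Kt.
  rewrite leNgt; apply/negP => td.
  have dV0 : 0 < d^-1 by rewrite invr_gt0.
  have t0 : 0 < - t by lra.
  apply: (dK (- t)^-1) => /=.
  + rewrite sub0r normrN gtr0_norm ?invr_gt0//.
    by rewrite -[ltRHS]invrK ltf_pV2 ?posrE//; lra.
  + by rewrite invr_gt0.
  have -> : - e - (- t)^-1 *: z = (- t)^-1 *: (t *: e - z).
    rewrite scalerBr scalerA invrN mulNr mulVf ?scaleN1r//.
    by rewrite -oppr_eq0 gt_eqF.
  by apply: coneZ => //; rewrite invr_ge0 ltW.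
Unshelve. all: by end_near. Qed.

Lemma gerstewitz_le0 z : gerstewitz K e z <= 0 -> K (- z).
Proof.
move=> g0.
have -> : - z = (gerstewitz K e z *: e - z) + (- gerstewitz K e z) *: e.
  by rewrite scaleNr addrAC subrr sub0r.
apply: coneD; first exact: gerstewitz_attained.
by apply: coneZ; [rewrite oppr_ge0|exact: interior_subset].
Qed.

End Cone.

(** * Euclidean norm, strong convexity and descent directions *)

Lemma enorm_sqr {R : realType} {n : nat} (u : 'rV[R]_n) :
  enorm u ^+ 2 = \sum_k u 0 k ^+ 2.
Proof. by rewrite sqr_sqrtr// sumr_ge0// => k _; exact: sqr_ge0. Qed.

Lemma enormZ_sqr {R : realType} {n : nat} (t : R) (u : 'rV[R]_n) :
  enorm (t *: u) ^+ 2 = t ^+ 2 * enorm u ^+ 2.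
Proof.
by rewrite !enorm_sqr mulr_sumr; apply: eq_bigr => k _; rewrite mxE exprMn.
Qed.

Lemma enorm_sqr_gt0 {R : realType} {n : nat} (u : 'rV[R]_n) :
  u != 0 -> 0 < enorm u ^+ 2.
Proof.
move=> u0; rewrite lt_def enorm_sqr sumr_ge0 ?andbT; last first.
  by move=> k _; exact: sqr_ge0.
apply: contra u0; rewrite psumr_eq0 => [/allP uk|k _]; last exact: sqr_ge0.
apply/eqP/rowP => k; rewrite mxE; apply/eqP.
by have := uk k (mem_index_enum k); rewrite /= expf_eq0.
Qed.

Section VectorFunction.
Context {R : realType} {n m : nat}.
Variable K : set 'rV[R]_m.
Hypothesis hK : closed_convex_pointed_solid_cone K.
Variable g : 'rV[R]_n -> 'rV[R]_m.
Hypothesis hg : forall k, twice_continuously_differentiable (component g k).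

Lemma second_difference_hessian_form x u :
  (t ^+ 2)^-1 *: (g (t *: u + x) + g (t *: - u + x) - 2 *: g x) @[t --> 0^'+]
    --> hessian_form g x u.
Proof.
apply: cvg_mx_entrywise => i k; rewrite ord1 mxE.
have [dg dgrad _] := hg k.
have [dDu <-] := hessian_derive2 (component g k) x u dg (dgrad x).
apply: cvg_trans (second_difference_cvg _ _ _ dg dDu).
by apply: near_eq_cvg; near=> t; rewrite !mxE mulrC.
Unshelve. all: by end_near. Qed.

(** Strong convexity at the midpoint [x] of [t *: u + x] and [t *: - u + x] bounds the second
    symmetric difference; closedness of [K] carries the bound to the limit. *)
Lemma strongly_convex_hessian_form e rho x u : strongly_convex K e rho g ->
  K (hessian_form g x u - (rho * enorm u ^+ 2) *: e).
Proof.
move=> scg; case: (hK) => _ cK _ _ _.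
apply: (@closed_cvg _ _ (0 : R)^'+ _ (fun t => (t ^+ 2)^-1 *:
    (g (t *: u + x) + g (t *: - u + x) - 2 *: g x) - (rho * enorm u ^+ 2) *: e)
    _ cK).
  near=> t.
  have t0 : 0 < t by [].
  have half01 : 0 <= (2^-1 : R) <= 1 by lra.
  have := scg (t *: u + x) (t *: - u + x) _ half01; rewrite /cone_le.
  have half : 1 - 2^-1 = 2^-1 :> R by field.
  have -> : 2^-1 *: (t *: u + x) + (1 - 2^-1) *: (t *: - u + x) = x.
    rewrite half -scalerDr scalerN addrACA subrr add0r scalerDr -scalerDl.
    by rewrite -[X in _ + X]half addrC subrK scale1r.
  have -> : t *: u + x - (t *: - u + x) = (2 * t) *: u.
    rewrite scalerN opprD opprK addrACA subrr addr0 -scalerDl.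
    by rewrite -mulr2n mulr_natl.
  rewrite enormZ_sqr half => Kt.
  (* The midpoint inequality has modulus term [2^-1 * rho * t ^+ 2 * enorm u ^+ 2], since the
     endpoints differ by [(2 * t) *: u]; this factor normalizes it to [rho * enorm u ^+ 2]. *)
  have t20 : 0 <= 2 / t ^+ 2 by rewrite divr_ge0// sqr_ge0.
  have := coneZ K hK _ _ t20 Kt; congr K.
  apply/rowP => k; rewrite !mxE; field.
  by rewrite gt_eqF.
by apply: cvgB; [exact: second_difference_hessian_form|exact: cvg_cst].
Unshelve. all: by end_near. Qed.

(** The negated difference quotient converges to an interior point of [K], hence is eventually
    interior; multiplying by [t > 0] preserves this. *)
Lemma jacobian_descent x u : K° (- (u *m 'J g x)) ->
  \forall t \near 0^'+, K° (g x - g (t *: u + x)).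
Proof.
have dg : differentiable g x.
  by apply: differentiable_row => k; have [] := hg k.
have quotient_cvg : - (t^-1 *: (g (t *: u + x) - g x)) @[t --> 0^'+]
    --> - (u *m 'J g x).
  apply: cvgN; rewrite -deriveEjacobian//.
  exact/cvg_dnbhs_at_right/diff_derivable.
move=> /nbhs_interior /quotient_cvg near_descent; near=> t.
have t0 : 0 < t by [].
have -> : g x - g (t *: u + x) = t *: - (t^-1 *: (g (t *: u + x) - g x)).
  by rewrite scalerN scalerKV ?opprB// gt_eqF.
apply: coneZ_interior => //.
by near: t.
Unshelve. all: by end_near. Qed.

Lemma gerstewitz_descent e rho x u : K° e -> ~ K° 0 -> 0 < rho ->
  strongly_convex K e rho g -> u != 0 ->
  gerstewitz K e (u *m 'J g x + 2^-1 *: hessian_form g x u) <= 0 ->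
  \forall t \near 0^'+, K° (g x - g (t *: u + x)).
Proof.
move=> he K0 rho0 scg u0 /(gerstewitz_le0 _ hK _ he K0) Kmodel.
apply: jacobian_descent.
have Khess := strongly_convex_hessian_form _ _ x u scg.
(* Two summands lie in [K], by the sign of the model and by strong convexity; the third is a
   positive multiple of the interior point [e] because [u != 0]. *)
have -> : - (u *m 'J g x) =
    - (u *m 'J g x + 2^-1 *: hessian_form g x u) +
    (2^-1 *: (hessian_form g x u - (rho * enorm u ^+ 2) *: e) +
     (2^-1 * (rho * enorm u ^+ 2)) *: e).
  by rewrite scalerBr scalerA subrK opprD subrK.
apply: coneD_interior => //; apply: coneD_interior => //.
  by apply: coneZ => //; rewrite invr_ge0.
apply: coneZ_interior => //.
by rewrite mulr_gt0 ?invr_gt0// mulr_gt0// enorm_sqr_gt0.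
Qed.

End VectorFunction.

(** * Domination by minimal values, and the conclusion *)

Lemma Min_domination {R : realType} {n m p : nat} (K : set 'rV[R]_m)
  (f : 'I_p -> 'rV[R]_n -> 'rV[R]_m) (x : 'rV[R]_n) (i : 'I_p) :
  closed_convex_pointed_solid_cone K ->
  exists2 j, I_min K f x j & K (f i x - f j x).
Proof.
move=> hK.
(* Among the f j x below f i x, one with the fewest values below it is
   minimal. *)
pose below j := [set l : 'I_p | `[< K (f j x - f l x) >]]%SET.
have ii : i \in below i by rewrite inE; apply/asboolP; rewrite subrr; exact: cone0.
have [j] := @arg_minnP _ i [in below i] (fun j => #|below j|) ii.
rewrite /= inE => /asboolP Kij min_j; exists j => //.
split; first by exists j.
apply/seteqP; split=> [_ [[k Kk <-] [l _ /= flE]]|_ ->] /=; last first.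
  by split; [exists 0; rewrite ?subr0//; exact: cone0|exists j].
have Kjl : K (f j x - f l x) by rewrite flE opprB addrC subrK.
rewrite -flE; have [//|flj] := eqVneq (f l x) (f j x); exfalso.
have Kil : K (f i x - f l x).
  by rewrite -(subrK (f j x) (f i x)) -addrA; exact: coneD.
have := min_j l; rewrite /= inE => /(_ (asboolT Kil)).
rewrite leqNgt => /negP; apply.
(* Transitivity gives the inclusion of [below l] in [below j]; antisymmetry excludes [j] itself from
   [below l]. *)
apply/proper_card/properP; split.
  apply/fintype.subsetP => q; rewrite !inE => Klq.
  by rewrite -(subrK (f l x) (f j x)) -addrA; exact: coneD.
exists j; rewrite inE; first by apply/asboolP; rewrite subrr; exact: cone0.
apply/asboolP => Klj; case/eqP: flj; apply/subr0_eq.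
by apply: (cone_antisym _ hK _ Klj); rewrite opprB.
Qed.

Theorem proposition3p9 (R : realType) (n m p : nat)
  (K : set 'rV[R]_m) (e : 'rV[R]_m) (rho : 'I_p -> R)
  (f : 'I_p -> 'rV[R]_n -> 'rV[R]_m)
  (r : forall x : 'rV[R]_n, 'I_(w K f x) -> 'rV[R]_m)
  (xbar : 'rV[R]_n) (abar : {ffun 'I_(w K f xbar) -> 'I_p})
  (ubar : 'rV[R]_n)
  (hp : (0 < p)%N)
  (hK : closed_convex_pointed_solid_cone K)
  (he : K° e)
  (hf : forall (i : 'I_p) (k : 'I_m),
    twice_continuously_differentiable (component (f i) k))
  (hrho : forall i : 'I_p, 0 < rho i)
  (hsc : forall i : 'I_p, strongly_convex K e (rho i) (f i))
  (hr : enumerates K f r)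
  (hxbar : weakly_minimal K f xbar)
  (habar : partition_set K f r xbar abar)
  (hubar : Phi K e f r xbar = xi K e f xbar abar ubar) :
  ubar = 0.
Proof.
(* 0 in int K would make lower_less reflexive; this also rules out m = 0,
   where setmin in gerstewitz takes its junk value. *)
have K0 : ~ K° 0.
  move=> K0; apply: hxbar; exists xbar => b Fb.
  by exists b => //; exists 0; rewrite ?addr0.
have xi0 a : xi K e f xbar a 0 <= 0.
  apply: setmax_le => // _ [j _ <-].
  apply: setmin_le0 => /=; exists 0; first exact: cone0.
  rewrite addr0 scale0r mul0mx add0r.
  have -> : hessian_form (f (a j)) xbar 0 = 0.
    by apply/rowP => k; rewrite [LHS]mxE !mul0mx [LHS]mxE [RHS]mxE.
  by rewrite scaler0.
(* If the minimum defining Phi is not attained, its junk value 0 still gives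
   the bound. *)
have xi_le0 : xi K e f xbar abar ubar <= 0.
  rewrite -hubar /Phi /setmin; case: xgetP => [t -> [_ lbt]|_ //].
  by apply: le_trans (lbt _ _) (xi0 abar); exists (abar, 0).
have [//|u0] := eqVneq ubar 0; case: hxbar.
(* There are finitely many indices [j], so one small step serves them all. *)
have descent : \forall t \near (0 : R)^'+, forall j : 'I_(w K f xbar),
    K° (f (abar j) xbar - f (abar j) (t *: ubar + xbar)).
  apply: filter_forall => j.
  apply: (@gerstewitz_descent _ _ _ K hK _ (hf _) e (rho (abar j))) => //.
  apply: le_trans xi_le0; rewrite /xi.
  exact: (le_setmax_range (fun j => gerstewitz K e
    (ubar *m 'J (f (abar j)) xbar + 2^-1 *: hessian_form (f (abar j)) xbar ubar))).
near (0 : R)^'+ => t.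
exists (t *: ubar + xbar) => _ [i _ <-].
have [l Il Kil] := Min_domination K f xbar i hK.
(* Surjectivity of the enumeration finds the index [j] of the minimal value [f l xbar]; by
   membership in the partition set, [f (abar j)] takes that same value at [xbar]. *)
have [_ _ /(_ _ Il) [j _ rj]] := hr xbar.
have [_ fj] := habar j.
exists (f (abar j) (t *: ubar + xbar)); first by exists (abar j).
exists (f i xbar - f (abar j) (t *: ubar + xbar)); last by rewrite addrC subrK.
rewrite -(subrK (f (abar j) xbar) (f i xbar)) -addrA.
apply: coneD_interior => //; first by rewrite fj rj.
by move: j {rj fj}; near: t.
Unshelve. all: by end_near. Qed.
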